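(* For $\lambda\in(0,1)$ let $X=[0,1]^2$, let $S_0,S_1:X\to X$ be given by $S_0(x)=\lambda x$ and $S_1(x)=\lambda x+(1-\lambda,0)$, let $C=\{0\}\times[0,1]$, and let $F_C^\lambda$ be the unique non-empty compact set satisfying $F_C^\lambda=S_0(F_C^\lambda)\cup S_1(F_C^\lambda)\cup C$. Then for Lebesgue almost every $\lambda\in(1/2,0.668)$ the box dimension of $F_C^\lambda$ exists and \[ \dim_{\mathrm B} F_C^\lambda=\frac{\log(4\lambda)}{\log 2}. \]
   Context: For bounded $E\subseteq\mathbb{R}^n$ and $\delta>0$, $N_\delta(E)$ is the number of half-open cubes of the $\delta$-mesh aligned with the coordinate axes that intersect $E$; the upper and lower box dimensions are $\limsup_{\delta\to0}$ and $\liminf_{\delta\to0}$ of $\log N_\delta(E)/(-\log\delta)$, and the box dimension is their common value when they agree. *)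

(* Defs.v *)
From HB Require Import structures.
From mathcomp Require Import all_boot all_order all_algebra.
From mathcomp Require Import finmap.
From mathcomp Require Import all_classical all_reals all_analysis.
Set Implicit Arguments. Unset Strict Implicit. Unset Printing Implicit Defensive.
Import Order.TTheory GRing.Theory Num.Theory numFieldNormedType.Exports.
Local Open Scope classical_set_scope.
Local Open Scope ring_scope.

Definition mesh_cube {R : realType} (d : R) (ij : int * int) : set (R * R) :=
  [set p | (ij.1%:~R * d <= p.1 < (ij.1 + 1)%:~R * d) /\
           (ij.2%:~R * d <= p.2 < (ij.2 + 1)%:~R * d)].

(* N_d(E): number of d-mesh squares meeting E (finite for bounded E). *)
Definition mesh_count {R : realType} (d : R) (E : set (R * R)) : nat :=
  #|` fset_set [set ij : int * int | mesh_cube d ij `&` E !=set0] |%fset.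

Definition box_ratio {R : realType} (E : set (R * R)) (d : R) : R :=
  ln (mesh_count d E)%:R / (- ln d).

Definition has_box_dim {R : realType} (E : set (R * R)) (s : R) : Prop :=
  box_ratio E d @[d --> (0:R)^'+] --> s.

Definition unit_square {R : realType} : set (R * R) :=
  [set p | 0 <= p.1 <= 1 /\ 0 <= p.2 <= 1].

Definition S0 {R : realType} (l : R) (p : R * R) : R * R := (l * p.1, l * p.2).
Definition S1 {R : realType} (l : R) (p : R * R) : R * R :=
  (l * p.1 + (1 - l), l * p.2).

Definition condC {R : realType} : set (R * R) :=
  [set p | p.1 = 0 /\ 0 <= p.2 <= 1].

Definition is_inhom_attractor {R : realType} (l : R) (F : set (R * R)) : Prop :=
  [/\ F `<=` unit_square, F !=set0, compact F &
      F = S0 l @` F `|` S1 l @` F `|` condC].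

(* Main.v *)
Require Import Defs.
From HB Require Import structures.
From Stdlib Require Import ZArith.
From mathcomp Require Import all_boot all_order all_algebra.
From mathcomp Require Import finmap.
From mathcomp Require Import all_classical all_reals all_analysis.
From mathcomp Require Import measurable_realfun.
From mathcomp Require Import ssrZ zify ring lra.
From mathcomp Require polyrcf.
Set Implicit Arguments. Unset Strict Implicit. Unset Printing Implicit Defensive.
Import Order.TTheory GRing.Theory Num.Theory numFieldNormedType.Exports.
Local Open Scope classical_set_scope.
Local Open Scope ring_scope.
Delimit Scope Z_scope with coqZ.

(** F contains, for every binary word w of length k, the vertical segment of height l^k above
    the point x_w = (1 - l) * sum_i w_i l^i, and its part outside the segments of level < n lies
    in [0, 1] x [0, l^n].  For d ~ 2^-n, counting the squares met by the segments of level < n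
    and by that strip gives N_d(F) <= C (4 l)^n.  Conversely the segments of level n alone give
    N_d(F) >= (number of columns containing some x_w) * l^n / d, and by Cauchy-Schwarz the number
    of columns is at least 4^n / P_n, where P_n counts the pairs of words with |x_v - x_w| < d.
    The expectation of P_n over l in [a, 0.668], a > 1/2, is O(2^n) by transversality: a
    polynomial f with coefficients in {-1, 0, 1} and f(0) = 1 has no near-double zero in
    [1/2, 0.668].  Borel-Cantelli then gives P_n <= (n + 1)(n + 2) 2^n eventually, for a.e. l.

    Transversality is checked by a finite search: on each of 19 small intervals, every sequence
    of digits has a prefix for which some functional t f - x f', with t a natural number, is
    bounded away from 0 whatever the remaining digits are. *)

(** * Transversality *)

Definition scale : Z := 1048576%coqZ.

(** Fixed-point interval arithmetic for successive powers of an x in [p/100000, q/100000], starting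
    from an enclosure [l], [u] of one of them. Floor division rounds the lower ends down, and the
    [+ 1] rounds the upper ends up. *)
Fixpoint power_table (p q : Z) (k : nat) (l u : Z) : seq (Z * Z) :=
  if k is k'.+1 then
    (l, u) :: power_table p q k' (l * p / 100000)%coqZ (u * q / 100000 + 1)%coqZ
  else [::].

(* The constants 16 and 97 come from [sum_i i x^i <= 97/16] for x <= 0.668. *)
Fixpoint tail_bound (k : nat) (T : seq (Z * Z)) : Z :=
  match T with
  | [::] => 0%coqZ
  | (_, u) :: T' =>
    if k is k'.+1 then (Z.of_nat k * 16 * u + tail_bound k' T')%coqZ
    else (97 * u)%coqZ
  end.

(* A state [Al, Au, Bl, Bu] at depth [m] encodes a prefix a_0, ..., a_(m-1) of digits:
   with A = sum a_i x^i and B = sum i a_i x^i, the number scale * (t A - B) lies between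
   t Al - Bl and t Au - Bu for every t >= m (all weights t - i are then nonnegative).
   The state is separated when, for t = m + k, the remaining digits cannot make
   t f - x f' vanish. *)
Definition separated (m k : nat) (T : seq (Z * Z)) (Al Au Bl Bu : Z) : bool :=
  (k < size T)%N &&
  (let s := tail_bound k T in
   let t := Z.of_nat (m + k) in
   (s <? 16 * (t * Al - Bl))%coqZ || (16 * (t * Au - Bu) <? - s)%coqZ).

(** The three recursive calls are the digits -1, 0, 1 in position [m]; the list holds the offsets k
    = t - m that are tried. *)
Fixpoint search (T : seq (Z * Z)) (m : nat) (Al Au Bl Bu : Z) : bool :=
  if has (fun k => separated m k T Al Au Bl Bu) [:: 3; 2; 4; 0]%N then true
  else match T with
  | [::] => false
  | (l, u) :: T' =>
    let n := Z.of_nat m in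
    if search T' m.+1 (Al - u) (Au - l) (Bl - n * u) (Bu - n * l) then
      if search T' m.+1 Al Au Bl Bu then
        search T' m.+1 (Al + l) (Au + u) (Bl + n * l) (Bu + n * u)
      else false
    else false
  end%coqZ.

(** The digit a_0 = 1 is already consumed: depth 1, A = [scale], B = 0, and a table for x, ...,
    x^30. *)
Definition check_interval (p q : Z) : bool :=
  search (power_table p q 30 (scale * p / 100000)%coqZ (scale * q / 100000 + 1)%coqZ)
    1 scale scale 0%coqZ 0%coqZ.

(* Found by a greedy numerical search; the pieces shrink because a double zero occurs
   near 0.66848. *)
Definition endpoints : seq Z := [:: 50000; 63610; 64344; 64534; 64801; 65175;
  65699; 66073; 66169; 66265; 66361; 66496; 66592; 66640; 66674; 66722; 66756;
  66780; 66792; 66800]%coqZ.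

Lemma check_intervals : all (fun pq => (0 <=? pq.1)%coqZ && check_interval pq.1 pq.2)
  (zip endpoints (behead endpoints)).
Proof. by vm_compute. Qed.

(* [search] is written with [if] because the bytecode machine evaluates both arguments of
   [||] and [&&]. *)
Lemma searchE T m Al Au Bl Bu : search T m Al Au Bl Bu =
  has (fun k => separated m k T Al Au Bl Bu) [:: 3; 2; 4; 0]%N ||
  match T with
  | [::] => false
  | (l, u) :: T' =>
    let n := Z.of_nat m in
    [&& search T' m.+1 (Al - u) (Au - l) (Bl - n * u) (Bu - n * l),
        search T' m.+1 Al Au Bl Bu &
        search T' m.+1 (Al + l) (Au + u) (Bl + n * l) (Bu + n * u)]
  end%coqZ.
Proof. by case: T => [|[]]. Qed.

(** * Soundness of the finite search *)

Section Soundness.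
Local Arguments Z.mul : simpl never.
Local Arguments Z.add : simpl never.
Local Arguments Z.sub : simpl never.
Local Arguments Z.of_nat : simpl never.
Variable R : realFieldType.
Implicit Types (x : R) (z : Z) (a : nat -> R).

Definition Z2R z : R := (int_of_Z z)%:~R.

Lemma Z2R0 : Z2R 0 = 0. Proof. by []. Qed.

Lemma Z2RD z1 z2 : Z2R (z1 + z2)%coqZ = Z2R z1 + Z2R z2.
Proof. by rewrite /Z2R -intrD; congr _%:~R; lia. Qed.

Lemma Z2RN z : Z2R (- z)%coqZ = - Z2R z.
Proof. by rewrite /Z2R -mulrNz; congr _%:~R; lia. Qed.

Lemma Z2RB z1 z2 : Z2R (z1 - z2)%coqZ = Z2R z1 - Z2R z2.
Proof. by rewrite -Z.add_opp_r Z2RD Z2RN. Qed.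

Lemma Z2RM z1 z2 : Z2R (z1 * z2)%coqZ = Z2R z1 * Z2R z2.
Proof. by rewrite /Z2R -intrM; congr _%:~R; lia. Qed.

Lemma Z2R_nat n : Z2R (Z.of_nat n) = n%:R.
Proof. by rewrite /Z2R pmulrn; congr _%:~R; lia. Qed.

Lemma Z2R_le z1 z2 : (z1 <= z2)%coqZ -> Z2R z1 <= Z2R z2.
Proof. by move=> h; rewrite /Z2R ler_int; lia. Qed.

(** The gap 1 between distinct integers is what becomes the uniform lower bound in
    [search_sound]. *)
Lemma Z2R_lt z1 z2 : (z1 < z2)%coqZ -> Z2R z1 + 1 <= Z2R z2.
Proof. by move=> h; rewrite /Z2R -[1]/(1%:~R) -intrD ler_int; lia. Qed.

Definition ZR := (Z2RD, Z2RB, Z2RN, Z2RM, Z2R_nat).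

Definition table_for (S : R) x (m : nat) (T : seq (Z * Z)) :=
  forall i, (i < size T)%N ->
    Z2R (nth (0, 0)%coqZ T i).1 <= S * x ^+ (m + i) <= Z2R (nth (0, 0)%coqZ T i).2.

Lemma table_for_cons S x m l u T : table_for S x m ((l, u) :: T) ->
  (Z2R l <= S * x ^+ m <= Z2R u) /\ table_for S x m.+1 T.
Proof.
move=> h; split; first by have := h 0 isT; rewrite addn0.
by move=> i hi; have := h i.+1 hi; rewrite addnS.
Qed.

Lemma power_table_for (S : R) x p q k m l u : 0 <= S -> 0 <= x ->
  (0 <= p)%coqZ -> Z2R p <= Z2R 100000 * x <= Z2R q -> (0 <= l)%coqZ ->
  Z2R l <= S * x ^+ m <= Z2R u -> table_for S x m (power_table p q k l u).
Proof.
move=> S0 x0 p0 /andP[hp hq].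
elim: k m l u => [|k IH] m l u l0 /andP[hl hu] [|i] //=.
  by rewrite addn0 hl hu.
have Sx0 : 0 <= S * x ^+ m by rewrite mulr_ge0 // exprn_ge0.
have d0 : (0 < 100000)%coqZ by [].
have D0 : 0 < Z2R 100000 by apply: lt_le_trans ltr01 _; exact: (@Z2R_le 1).
move=> hi; rewrite addnS -addSn; apply: IH => //.
  by apply: Z.div_pos => //; lia.
rewrite exprSr mulrA; apply/andP; split.
  have : Z2R (100000 * (l * p / 100000))%coqZ <= Z2R (l * p)%coqZ.
    by apply: Z2R_le; apply: Z.mul_div_le.
  rewrite !ZR; move: D0.
  have : Z2R l * Z2R p <= S * x ^+ m * (Z2R 100000 * x).
    apply: ler_pM => //; rewrite -[0]/(Z2R 0%coqZ); exact: Z2R_le.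
  set v := Z2R (_ / _)%coqZ; set w := S * x ^+ m; set c := Z2R 100000; move=> *.
  rewrite -(ler_pM2l (_ : 0 < c)) //; lra.
have : Z2R (u * q)%coqZ <= Z2R (100000 * (u * q / 100000 + 1))%coqZ.
  by apply: Z2R_le; have := Z.mul_succ_div_gt (u * q) 100000 d0; lia.
rewrite !ZR (_ : Z2R 1 = 1) //; move: D0.
have : S * x ^+ m * (Z2R 100000 * x) <= Z2R u * Z2R q.
  by apply: ler_pM => //; rewrite mulr_ge0.
set v := Z2R (_ / _)%coqZ; set w := S * x ^+ m; set c := Z2R 100000; move=> *.
rewrite -(ler_pM2l (_ : 0 < c)) //; lra.
Qed.

(* Induction on n: the bound [j K + c] with [K = 250/83 = 1/(1 - 0.668)] satisfies
   [j + x ((j + 1) K + c) <= j K + c]. *)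
Lemma arith_geom_sum_le x n j : 0 <= x <= 668%:R / 1000%:R ->
  \sum_(i < n) (i + j)%:R * x ^+ i <= j%:R * (250%:R / 83%:R) + 97%:R / 16%:R.
Proof.
move=> /andP[x0 x1]; elim: n j => [|n IH] j; have j0 : 0 <= j%:R :> R by [].
  by rewrite big_ord0; lra.
rewrite big_ord_recl /= expr0 mulr1 add0n.
under eq_bigr => i _ do rewrite /bump /= add1n exprS mulrCA addSnnS.
rewrite -mulr_sumr.
have := ler_wpM2l x0 (IH j.+1); rewrite -natr1.
set s := \sum_(i < n) _ => h.
move: (x1); rewrite -subr_ge0 => /mulr_ge0/(_ j0).
lra.
Qed.

(** The first k terms are bounded one table entry at a time. From index k on the weights are 0, 1,
    2, ..., so the rest is at most 97/16 times the entry there; the factor 16 clears this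
    denominator. *)
Lemma tail_bound_ge S x k T m n : 0 <= S -> 0 <= x <= 668%:R / 1000%:R ->
  (k < size T)%N -> table_for S x m T ->
  16 * S * (\sum_(i < n) `|k%:R - i%:R| * x ^+ (m + i)) <= Z2R (tail_bound k T).
Proof.
move=> S0 x01; have /andP[x0 _] := x01.
have E : forall z : Z, Z2R (16 * z)%coqZ = 16 * Z2R z by move=> z; rewrite Z2RM.
elim: T k m n => [|[l u] T IH] [|k] m n //= hk /table_for_cons[/andP[_ hu] hT].
  under eq_bigr => i _ do rewrite sub0r normrN ger0_norm // exprD mulrCA.
  rewrite -mulr_sumr.
  under eq_bigr => i _ do rewrite -[(i : nat)]addn0.
  have := arith_geom_sum_le n 0 x01; rewrite mul0r add0r.
  under [X in X <= _ -> _]eq_bigr => i _ do rewrite -[X in _ * x ^+ X]addn0.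
  set s := \sum_(i < n) _ => hs.
  rewrite Z2RM (_ : Z2R 97%coqZ = 97) ?/Z2R //.
  have Sx0 : 0 <= S * x ^+ m by rewrite mulr_ge0 // exprn_ge0.
  have := ler_wpM2l Sx0 hs; move: hu; rewrite /Z2R.
  nra.
case: n => [|n].
  rewrite big_ord0 mulr0.
  have h := IH k m.+1 0%N hk hT; rewrite big_ord0 mulr0 in h.
  rewrite Z2RD !Z2RM Z2R_nat.
  rewrite addr_ge0 // !mulr_ge0 // ?ler0n //; last first.
    by apply: le_trans hu; rewrite mulr_ge0 // exprn_ge0.
rewrite big_ord_recl /= subr0 addn0 mulrDr Z2RD lerD //.
  rewrite !Z2RM Z2R_nat ger0_norm //.
  rewrite (_ : Z2R 16%coqZ = 16) ?/Z2R //.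
  have k0 : 0 <= k.+1%:R :> R by [].
  have := ler_wpM2l k0 hu; rewrite /Z2R; nra.
under eq_bigr => i _ do rewrite /bump /= add1n addnS -addSn -!natr1
   opprD addrACA subrr addr0.
exact: IH.
Qed.

(** Induction on the table. At a separated node, t = m + k works: the head of the sum is controlled
    by the state and exceeds the tail bound. Otherwise the digit [a m] selects the branch to
    follow. *)
Lemma search_sound S x a T m Al Au Bl Bu : 0 <= S -> 0 <= x <= 668%:R / 1000%:R ->
  (forall i, (a i == -1) || (a i == 0) || (a i == 1)) ->
  search T m Al Au Bl Bu -> table_for S x m T ->
  (forall t, (m <= t)%N ->
    t%:R * Z2R Al - Z2R Bl <= S * (\sum_(i < m) a i * (t%:R - i%:R) * x ^+ i)
      <= t%:R * Z2R Au - Z2R Bu) ->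
  forall N, (m + size T <= N)%N -> exists t, (t <= m + size T)%N /\
    1 <= 16 * S * `|\sum_(i < N) a i * (t%:R - i%:R) * x ^+ i|.
Proof.
move=> S0 x01 ha; have /andP[x0 _] := x01.
elim: T m Al Au Bl Bu => [|[l u] T IH] m Al Au Bl Bu.
  by rewrite searchE => /orP[/hasP[k _ /andP[]]|//]; rewrite ltn0.
rewrite searchE => /orP[/hasP[k _ /andP[hk hsep]]|/and3P[hm h0 hp]] hT hA N hN.
  exists (m + k)%N; split; first by move: hk => /=; lia.
  have -> : N = (m + (N - m))%N by move: hN => /=; lia.
  rewrite big_split_ord /=.
  have := hA (m + k)%N (leq_addr _ _).
  set A := \sum_(i < m) _; set B := \sum_(i < N - m) _ => /andP[hA1 hA2].
  have hB : 16 * S * `|B| <= Z2R (tail_bound k ((l, u) :: T)).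
    apply: le_trans (tail_bound_ge (N - m) S0 x01 hk hT).
    apply: ler_wpM2l; first by rewrite mulr_ge0.
    apply: le_trans (ler_norm_sum _ _ _) _; apply: ler_sum => i _.
    rewrite !normrM normrX (ger0_norm x0).
    have -> : (m + k)%:R - (rshift m i)%:R = k%:R - i%:R :> R.
      by rewrite /= !natrD; ring.
    rewrite -[leRHS]mul1r mulrA ler_wpM2r ?exprn_ge0 //.
    rewrite ler_wpM2r //.
    by case/orP: (ha (m + i)%N) => [/orP[]|] /eqP ->; rewrite ?normrN ?normr1 ?normr0.
  have E16 : Z2R 16%coqZ = 16 by [].
  have hA1' := ler_wpM2l (ler0n R 16) hA1.
  have hA2' := ler_wpM2l (ler0n R 16) hA2.
  have h16S : 0 <= 16 * S by rewrite mulr_ge0.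
  case/orP: hsep => /Z.ltb_lt /Z2R_lt; rewrite !ZR E16 => h.
    have : 16 * S * A - 16 * S * `|B| <= 16 * S * `|A + B|.
      rewrite -mulrBr ler_wpM2l // -[(`|B|)]normrN -{1}[A](addrK B).
      apply: le_trans (_ : `|A + B - B| - `|- B| <= _).
        by rewrite lerD2r ler_norm.
      by rewrite lerBlDr ler_normD.
    lra.
  have : 16 * S * (- A) - 16 * S * `|B| <= 16 * S * `|A + B|.
    rewrite -mulrBr ler_wpM2l // -[(`|A + B|)]normrN opprD.
    apply: le_trans (_ : `|- A - B + B| - `|B| <= _).
      by rewrite subrK lerD2r ler_norm.
    by rewrite lerBlDr ler_normD.
  lra.
have [/andP[hl hu] hT'] := table_for_cons hT.
(* The descent common to the three digits; [d] stands for the weight t - m of the new digit. *)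
have step Al' Au' Bl' Bu' : search T m.+1 Al' Au' Bl' Bu' ->
    (forall d : R, 0 <= d ->
     d * (Z2R Al' - Z2R Al) - (Z2R Bl' - m%:R * Z2R Al' - Z2R Bl + m%:R * Z2R Al)
     <= S * (a m * d * x ^+ m) <= d * (Z2R Au' - Z2R Au) - (Z2R Bu' - m%:R * Z2R Au' - Z2R Bu + m%:R * Z2R Au)) ->
    exists t, (t <= m + size ((l, u) :: T))%N /\
    1 <= 16 * S * `|\sum_(i < N) a i * (t%:R - i%:R) * x ^+ i|.
  move=> hs hd; rewrite /= addnS -addSn; apply: IH hs hT' _ _ _; last first.
    by move: hN => /=; lia.
  move=> t ht; rewrite big_ord_recr /= mulrDr.
  have /andP[] := hA t (ltnW ht).
  have d0 : 0 <= t%:R - m%:R :> R by rewrite subr_ge0 ler_nat ltnW.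
  have /andP[] := hd _ d0; nra.
have ld d : 0 <= d -> d * Z2R l <= d * (S * x ^+ m) <= d * Z2R u.
  by move=> d0; rewrite !ler_wpM2l.
case/orP: (ha m) => [/orP[]|] /eqP am.
- by apply: step hm _ => d /ld /andP[]; rewrite !ZR am; nra.
- by apply: step h0 _ => d /ld /andP[]; rewrite ?ZR am; nra.
- by apply: step hp _ => d /ld /andP[]; rewrite !ZR am; nra.
Qed.

Lemma in_subinterval (P : pred (Z * Z)) (y : R) e s :
  all P (zip (e :: s) s) -> Z2R e <= y <= Z2R (last e s) -> (0 < size s)%N ->
  exists2 pq, P pq & Z2R pq.1 <= y <= Z2R pq.2.
Proof.
elim: s e => // e' s IH e /= /andP[He Hs] /andP[ye ys] _.
have [ye'|/ltW ye'] := leP y (Z2R e'); first by exists (e, e') => //=; rewrite ye.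
have [s0|s0] := posnP (size s); last by apply: IH Hs _ s0; rewrite ye'.
by move: ys; rewrite (size0nil s0) /= => ys; exists (e, e'); rewrite //= ye.
Qed.

Lemma rescale (u v w x : R) : u * 2 = w -> v * 1000 = w * 668 -> 0 < w ->
  1%:R / 2%:R <= x -> x <= 668%:R / 1000%:R -> u <= w * x <= v.
Proof. by move=> *; apply/andP; split; nra. Qed.

Lemma Z2R_gt0 z : (0 < z)%coqZ -> 0 < Z2R z.
Proof. by move=> h; rewrite /Z2R ltr0z; lia. Qed.

Lemma endpoints_cover x : 1%:R / 2%:R <= x <= 668%:R / 1000%:R ->
  Z2R 50000 <= Z2R 100000 * x <= Z2R 66800.
Proof.
move=> /andP[]; apply: rescale; last exact: Z2R_gt0.
  by rewrite (_ : 100000%coqZ = 50000 * Z.of_nat 2)%coqZ // Z2RM Z2R_nat.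
have e : (66800 * Z.of_nat 1000 = 100000 * Z.of_nat 668)%coqZ by [].
by rewrite -(Z2R_nat 1000) -(Z2R_nat 668) -[LHS]Z2RM -[RHS]Z2RM e.
Qed.

Lemma checked_interval x : 1%:R / 2%:R <= x <= 668%:R / 1000%:R ->
  exists p q, [/\ (0 <= p)%coqZ, Z2R p <= Z2R 100000 * x <= Z2R q & check_interval p q].
Proof.
move=> /endpoints_cover hx.
have [//|[p q] /andP[/Z.leb_le p0 hs] hpq] := in_subinterval check_intervals hx _.
by exists p, q.
Qed.

Lemma power_tableS p q k l u : power_table p q k.+1 l u =
  (l, u) :: power_table p q k (l * p / 100000) (u * q / 100000 + 1).
Proof. by []. Qed.

Lemma size_power_table p q k l u : size (power_table p q k l u) = k.
Proof. by elim: k l u => //= k IH l u; rewrite IH. Qed.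

(** The bound 31 is the starting depth 1 plus the 30 entries of the table. *)
Lemma transversality_functional : exists2 S : R, 0 < S & forall x a N,
  1%:R / 2%:R <= x <= 668%:R / 1000%:R -> a 0%N = 1 ->
  (forall i, (a i == -1) || (a i == 0) || (a i == 1)) -> (31 <= N)%N ->
  exists t, (t <= 31)%N /\
    1 <= S * `|\sum_(i < N) a i * (t%:R - i%:R) * x ^+ i|.
Proof.
have s0 : 0 < Z2R scale by exact: Z2R_gt0.
exists (16 * Z2R scale); first by rewrite mulr_gt0.
move=> x a N hx a0 ha hN.
have [p [q [p0 hpq]]] := checked_interval hx.
have /andP[x1 x2] := hx.
have x0 : 0 <= x by apply: le_trans x1; rewrite divr_ge0.
have x02 : 0 <= x <= 668%:R / 1000%:R by rewrite x0.
rewrite /check_interval.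
(* A table of 31 entries starting at x^0 = 1, which is enclosed exactly by [scale]; dropping its
   head leaves the table used by [check_interval]. *)
have := @power_table_for (Z2R scale) x p q 31 0 scale scale (ltW s0) x0 p0 hpq.
rewrite power_tableS.
have := size_power_table p q 30 (scale * p / 100000) (scale * q / 100000 + 1).
move: (power_table p q 30 _ _) => T szT hT hs.
have {}hT : table_for (Z2R scale) x 1 T.
  by have [] := table_for_cons (hT (_ : (0 <= scale)%coqZ) _); rewrite // expr0 mulr1 lexx.
have := search_sound (ltW s0) x02 ha hs hT.
rewrite szT Z2R0; move: (Z2R scale) => S H.
have [||t] := H _ N => //; last by move=> ?; exists t.
by move=> t _; rewrite big_ord1 a0 expr0 mulr1 mul1r !subr0 mulrC lexx.
Qed.

End Soundness.

Section Transversality.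
Variable R : realFieldType.
Implicit Type x : R.


Definition digit_poly (p : {poly R}) :=
  forall i, (p`_i == -1) || (p`_i == 0) || (p`_i == 1).

Lemma horner_deriv_functional (p : {poly R}) x (t n : nat) : (size p <= n)%N ->
  \sum_(i < n.+1) p`_i * (t%:R - i%:R) * x ^+ i = t%:R * p.[x] - x * p^`().[x].
Proof.
move=> hp; rewrite (@horner_coef_wide _ n.+1) ?(leqW hp) //.
rewrite (@horner_coef_wide _ n p^`()); last first.
  by apply: leq_trans hp; apply: leq_trans (size_poly _ _) (leq_pred _).
have -> : x * (\sum_(i < n) p^`()`_i * x ^+ i) = \sum_(i < n.+1) p`_i * i%:R * x ^+ i.
  rewrite big_ord_recl mulr0 mul0r add0r mulr_sumr; apply: eq_bigr => i _.
  rewrite coef_deriv lift0 exprS -mulr_natr.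
  by rewrite mul1r mulr_natr mulrCA.
rewrite mulr_sumr -sumrB; apply: eq_bigr => i _.
by rewrite mulrBr mulrBl [t%:R * (_ * _)]mulrCA mulrA.
Qed.

(** If |f| and |f'| were both below rho = 1/(32 S), then |t f - x f'| <= 31 |f| + |f'| < 32 rho =
    1/S for every t <= 31, contradicting [transversality_functional]. *)
Lemma transversality : exists2 rho : R, 0 < rho & forall (p : {poly R}) x,
  digit_poly p -> p`_0 = 1 -> 1%:R / 2%:R <= x <= 668%:R / 1000%:R ->
  `|p.[x]| < rho -> rho <= `|p^`().[x]|.
Proof.
have [S S0 H] := transversality_functional R.
exists (32%:R * S)^-1; first by rewrite invr_gt0 mulr_gt0.
move=> p x hp p0 hx h1; rewrite leNgt; apply/negP => h2.
have [t [ht]] := H x (fun i => p`_i) (size p + 31).+1 hx p0 hp (leqW (leq_addl _ _)).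
rewrite horner_deriv_functional ?leq_addr //; apply/negP; rewrite -ltNge.
set r := (32%:R * S)^-1 in h1 h2.
have r0 : 0 < r by rewrite invr_gt0 mulr_gt0.
have Sr : S * (32 * r) = 1.
  by rewrite mulrCA mulrA mulfV // mulf_neq0 // gt_eqF.
rewrite -[ltRHS]Sr ltr_pM2l //.
have /andP[x1 x2] := hx.
have x01 : `|x| <= 1 by rewrite ler_norml; apply/andP; split; lra.
apply: le_lt_trans (ler_normB _ _) _; rewrite !normrM ger0_norm //.
have t31 : t%:R <= 31 :> R by rewrite ler_nat.
have := ler_wpM2r (normr_ge0 p.[x]) t31.
have := ler_wpM2r (normr_ge0 p^`().[x]) x01.
lra.
Qed.

End Transversality.

(** * Measure of sublevel sets *)

Section Measure.
Variable R : realType.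
Notation mu := (@lebesgue_measure R).
Implicit Types (p : {poly R}) (x : R).

Definition sublevel p (r : R) : set R :=
  `[1%:R / 2%:R, 668%:R / 1000%:R] `&` [set x | `|p.[x]| < r].

Lemma measurable_small_horner p (r : R) : measurable [set x : R | `|p.[x]| < r].
Proof.
have -> : [set x : R | `|p.[x]| < r] = (fun x => `|p.[x]|) @^-1` `]-oo, r[.
  by apply/seteqP; split => x /=; rewrite in_itv.
rewrite -[X in measurable X]setTI.
have c : continuous (fun x => `|p.[x]|).
  by move=> x; apply: continuous_comp; [exact: continuous_horner|exact: norm_continuous].
exact: (continuous_measurable_fun c measurableT).
Qed.

Lemma measurable_sublevel p r : measurable (sublevel p r).
Proof. by apply: measurableI => //; exact: measurable_small_horner. Qed.

(** The coefficients of p' are at most i + 1 in modulus, and [arith_geom_sum_le] with j = 1 gives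
    250/83 + 97/16 < 10. *)
Lemma norm_deriv_le p x : digit_poly p -> 1%:R / 2%:R <= x <= 668%:R / 1000%:R ->
  `|p^`().[x]| <= 10.
Proof.
move=> hp /andP[x1 x2].
have x0 : 0 <= x by apply: le_trans x1; rewrite divr_ge0.
rewrite horner_coef; apply: le_trans (ler_norm_sum _ _ _) _.
apply: (@le_trans _ _ (\sum_(i < size p^`()) (i + 1)%:R * x ^+ i)); last first.
  have hx : 0 <= x <= 668%:R / 1000%:R by rewrite x0.
  apply: le_trans (arith_geom_sum_le _ 1 hx) _; lra.
apply: ler_sum => i _; rewrite normrM normrX (ger0_norm x0) ler_wpM2r ?exprn_ge0 //.
rewrite coef_deriv addn1 normrMn lerMn2r /=.
by case/orP: (hp i.+1) => [/orP[]|] /eqP ->; rewrite ?normrN ?normr1 ?normr0.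
Qed.

Lemma poly_mvt_le p x y : x <= y -> exists c, x <= c <= y /\
  p.[y] - p.[x] = p^`().[c] * (y - x).
Proof.
rewrite le_eqVlt => /predU1P[->|xy].
  by exists y; rewrite lexx !subrr mulr0.
have [c] := polyrcf.poly_mvt p xy.
by rewrite in_itv /= => /andP[xc cy] E; exists c; rewrite !ltW.
Qed.

Lemma measure_within (A : set R) (y r : R) : 0 <= r -> measurable A ->
  (forall x, A x -> `|x - y| <= r) -> (mu A <= (2 * r)%:E)%E.
Proof.
move=> r0 mA hA.
apply: (@le_trans _ _ (mu `[y - r, y + r])).
  apply: le_measure; rewrite ?inE //.
  by move=> x /hA; rewrite /= in_itv /= ler_norml => /andP[? ?]; apply/andP; split; lra.
rewrite lebesgue_measure_itv /= lte_fin; case: ifP => _.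
  by rewrite -EFinB lee_fin; lra.
by rewrite lee_fin mulr_ge0.
Qed.

(* Cut [1/2, 0.668] into pieces so short that |p| < rho on a whole piece as soon as
   |p| < rho / 2 somewhere in it; there |p'| >= rho, so p expands distances by rho. *)
Lemma measure_sublevel : exists2 C : R, 0 < C & forall p (r : R),
  digit_poly p -> p`_0 = 1 -> 0 < r -> (mu (sublevel p r) <= (C * r)%:E)%E.
Proof.
have [rho rho0 H] := transversality R.
(* As |p'| <= 10, p varies by at most rho / 2 over a length [h]. *)
set h := rho / 20.
have h0 : 0 < h by rewrite divr_gt0.
set L := Num.truncn (1 / h).
(* For r < rho / 2, each of the [L.+1] pieces contributes at most 4 r / rho; for r >= rho / 2, the
   second term makes the bound at least 1. *)
exists (4 / rho * L.+1%:R + 2 / rho).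
  by rewrite addr_gt0 ?divr_gt0 // mulr_gt0 ?divr_gt0.
move=> p r hp p0 r0.
have [rr|rr] := leP (rho / 2) r.
  apply: (@le_trans _ _ 1%E).
    apply: (@le_trans _ _ (mu `[1%:R / 2%:R, 668%:R / 1000%:R])).
      by apply: le_measure; rewrite ?inE //; [exact: measurable_sublevel | exact: subIsetl].
    rewrite lebesgue_measure_itv /= lte_fin; case: ifP => _; last exact: lee01.
    by rewrite -EFinB lee_fin; lra.
  rewrite lee_fin mulrDl.
  rewrite [leLHS](_ : 1 = 2 / rho * (rho / 2)); last by field; rewrite gt_eqF.
  apply: (@le_trans _ _ (2 / rho * r)).
    by rewrite ler_wpM2l // divr_ge0 // ltW.
  by rewrite lerDr mulr_ge0 ?(ltW r0) // mulr_ge0 // divr_ge0 // ltW.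
pose J k := sublevel p r `&` `[k%:R * h, k.+1%:R * h].
have mJ k : measurable (J k) by apply: measurableI => //; exact: measurable_sublevel.
have cover : sublevel p r `<=` \big[setU/set0]_(k < L.+1) J k.
  move=> x Ax; rewrite -bigcup_mkord.
  have [/=] := Ax; rewrite in_itv /= => /andP[x1 x2] _.
  have xh0 : 0 <= x / h by rewrite divr_ge0 ?(ltW h0) //; lra.
  exists (Num.truncn (x / h)) => /=.
    rewrite ltnS; apply: le_truncn; rewrite ler_pM2r ?invr_gt0 //; lra.
  split => //=; rewrite in_itv /=.
  have /andP[h1 h2] := truncn_itv xh0.
  by rewrite -ler_pdivlMr // h1 -ler_pdivrMr // ltW.
have bound k : (mu (J k) <= (4 / rho * r)%:E)%E.
  have [->|/set0P[y [[Iy py] Jy]]] := eqVneq (J k) set0.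
    by rewrite measure0 lee_fin mulr_ge0 ?(ltW r0) // divr_ge0 // ltW.
  move: Iy Jy; rewrite /= !in_itv /= => /andP[y1 y2] /andP[y3 y4].
  have small c : 1%:R / 2%:R <= c <= 668%:R / 1000%:R -> k%:R * h <= c <= k.+1%:R * h ->
      rho <= `|p^`().[c]|.
    move=> cI /andP[c3 c4]; apply: H => //.
    have cy : `|p.[c] - p.[y]| <= 10 * `|c - y|.
      wlog: c y cI y1 y2 y3 y4 c3 c4 {py} / c <= y => [W|].
        have [?|/ltW ?] := leP c y; first exact: W.
        move/andP: cI => [? ?]; rewrite distrC [X in _ * X]distrC.
        by apply: W; rewrite ?y1.
      move=> /(poly_mvt_le p)[z [/andP[z1 z2] E]].
      rewrite distrC E normrM [X in _ <= _ * X]distrC ler_wpM2r //.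
      by apply: norm_deriv_le => //; move/andP: cI => [? ?]; apply/andP; split; lra.
    have cyh : `|c - y| <= h.
      by move: c3 c4 y3 y4; rewrite -natr1 mulrDl mul1r ler_norml => *; apply/andP; split; lra.
    have : `|p.[c]| <= `|p.[c] - p.[y]| + `|p.[y]| by rewrite -{1}[p.[c]](subrK p.[y]) ler_normD.
    move: cyh py; rewrite /h /=; lra.
  apply: (le_trans (measure_within (y := y) (r := 2 / rho * r) _ (mJ k) _)); last 1 first.
  - by rewrite lee_fin; lra.
  - by rewrite mulr_ge0 ?(ltW r0) // divr_ge0 // ltW.
  move=> x [[Ix px] Jx]; move: Ix Jx; rewrite /= !in_itv /= => /andP[x1 x2] /andP[x3 x4].
  have : rho * `|x - y| <= `|p.[x] - p.[y]|.
    clear px py.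
    wlog: x y x1 x2 x3 x4 y1 y2 y3 y4 / x <= y => [W|].
      have [?|/ltW ?] := leP x y; first exact: W.
      by rewrite distrC [leRHS]distrC; apply: W.
    move=> /(poly_mvt_le p)[z [/andP[z1 z2] E]].
    rewrite distrC [leRHS]distrC E normrM ler_wpM2r //.
    by apply: small; apply/andP; split; lra.
  have : `|p.[x] - p.[y]| <= `|p.[x]| + `|p.[y]| by exact: ler_normB.
  move=> h1 h2; rewrite -(ler_pM2l rho0).
  have -> : rho * (2 / rho * r) = 2 * r by field; rewrite gt_eqF.
  move: px py => /=; lra.
apply: (le_trans (@content_subadditive _ _ _ mu (sublevel p r) J L.+1
  (fun k _ => mJ k) (measurable_sublevel p r) cover)).
apply: (@le_trans _ _ (\sum_(k < L.+1) (4 / rho * r)%:E)%E); first by apply: lee_sum => k _; exact: bound.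
rewrite sumEFin lee_fin sumr_const card_ord -[leLHS]mulr_natl mulrCA mulrA.
rewrite [leRHS]mulrDl lerDl.
by rewrite mulr_ge0 ?(ltW r0) // divr_ge0 // ltW.
Qed.

End Measure.

(** * Pairs of close words *)

Fixpoint words (n : nat) : seq (seq bool) :=
  if n is n'.+1 then map (cons false) (words n') ++ map (cons true) (words n')
  else [:: [::]].

Definition word_pairs n : seq (seq bool * seq bool) :=
  [seq (v, w) | v <- words n, w <- words n].

Lemma size_words n : size (words n) = (2 ^ n)%N.
Proof. by elim: n => //= n IH; rewrite size_cat !size_map IH expnS mul2n addnn. Qed.

Lemma size_word_pairs n : size (word_pairs n) = (4 ^ n)%N.
Proof. by rewrite size_allpairs size_words -expnMn. Qed.

Lemma mem_words n w : (w \in words n) = (size w == n).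
Proof.
elim: n w => [|n IH] [|b w] //=; first by rewrite mem_cat; apply/norP; split; apply/mapP => -[].
rewrite mem_cat eqSS -IH; case: b.
  rewrite mem_map; last by move=> ? ? [].
  by case: mapP => // -[? _ []].
rewrite [X in X || _]mem_map; last by move=> ? ? [].
by case: mapP => [[? _ []]|]; rewrite ?orbF.
Qed.

Section Words.
Variable R : realType.
Notation mu := (@lebesgue_measure R).
Implicit Types (p : {poly R}) (l r a : R) (u : seq bool * seq bool).

Definition word_poly (w : seq bool) : {poly R} :=
  foldr (fun (b : bool) p => (b : nat)%:R%:P + 'X * p) 0 w.

Lemma word_poly_cons (b : bool) w l :
  (word_poly (b :: w)).[l] = (b : nat)%:R + l * (word_poly w).[l].
Proof. by rewrite /= hornerD hornerC hornerM hornerX. Qed.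

(** The abscissa of the image of the origin under the composition of the maps indexed by [w], first
    letter outermost. *)
Definition word_pt l w : R := (1 - l) * (word_poly w).[l].

Lemma word_pt_nil l : word_pt l [::] = 0.
Proof. by rewrite /word_pt horner0 mulr0. Qed.

Lemma word_pt_cons l (b : bool) w :
  word_pt l (b :: w) = (1 - l) * (b : nat)%:R + l * word_pt l w.
Proof. by rewrite /word_pt word_poly_cons; ring. Qed.

Lemma coef_word_poly w i : (word_poly w)`_i = (nth false w i : nat)%:R.
Proof.
elim: w i => [|b w IH] [|i] /=; rewrite ?coef0 // coefD coefC coefXM /= ?addr0 //.
by rewrite add0r IH.
Qed.

Definition diff_poly u := word_poly u.1 - word_poly u.2.

Lemma diff_polyE v w l : (diff_poly (v, w)).[l] = (word_poly v).[l] - (word_poly w).[l].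
Proof. by rewrite /diff_poly hornerD hornerN. Qed.

Lemma digit_diff_poly u : digit_poly (diff_poly u).
Proof.
move=> i; rewrite coefB !coef_word_poly.
by do 2 case: nth; rewrite ?subrr ?subr0 ?sub0r ?eqxx ?orbT.
Qed.

Definition close_set a u r : set R :=
  `[a, 668%:R / 1000%:R] `&` [set l | `|(diff_poly u).[l]| < r].

Lemma measurable_close_set a u r : measurable (close_set a u r).
Proof. by apply: measurableI => //; exact: measurable_small_horner. Qed.

Lemma close_set_sublevel a v w r : 1%:R / 2%:R <= a ->
  close_set a (true :: v, false :: w) r `<=`
  sublevel (diff_poly (true :: v, false :: w)) r.
Proof.
move=> a2 l [] /=; rewrite in_itv /= => /andP[al l2] hl; split => //=.
by rewrite in_itv /= l2 (le_trans a2).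
Qed.

(** Transversality asks for constant coefficient +1, so pairs starting with (false, true) are first
    swapped. *)
Lemma close_setC a v w r : close_set a (v, w) r = close_set a (w, v) r.
Proof.
by congr (_ `&` _); apply/seteqP; split => l /=;
  rewrite !diff_polyE distrC.
Qed.

(** A common first letter cancels and leaves l times the difference of the tails, with l >= a. *)
Lemma close_set_cons a b v w r : 0 < a ->
  close_set a (b :: v, b :: w) r `<=` close_set a (v, w) (r / a).
Proof.
move=> a0 l [] /=; rewrite in_itv /= => /andP[al l2] hl; split => /=.
  by rewrite in_itv /= al.
have E : (diff_poly (b :: v, b :: w)).[l] = l * (diff_poly (v, w)).[l].
  by rewrite !diff_polyE !word_poly_cons; ring.
have l0 : 0 < l by exact: lt_le_trans al.
move: hl; rewrite E normrM gtr0_norm // => hl.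
by rewrite ltr_pdivlMr // mulrC; apply: le_lt_trans hl; rewrite ler_wpM2r.
Qed.

Lemma big_words_const n (c : R) :
  (\sum_(u <- word_pairs n) c%:E = (4%:R ^+ n * c)%:E)%E.
Proof.
rewrite sumEFin big_const_seq count_predT size_word_pairs iter_addr_0.
by congr EFin; rewrite -[LHS]mulr_natl natrX.
Qed.

Lemma big_word_pairsS n (F : seq bool * seq bool -> \bar R) :
  (\sum_(u <- word_pairs n.+1) F u =
   \sum_(u <- word_pairs n) (F (false :: u.1, false :: u.2) + F (false :: u.1, true :: u.2)
     + (F (true :: u.1, false :: u.2) + F (true :: u.1, true :: u.2))))%E.
Proof.
rewrite !big_allpairs /= big_cat !big_map /= -big_split /=; apply: eq_bigr => v _.
by rewrite !big_cat !big_map /= -!big_split /=.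
Qed.

(* Splitting off the first letters: if they differ, transversality applies; if they agree,
   the closeness threshold is multiplied by at most 1/a, and 2/a < 4. *)
Lemma sum_measure_close_set a : 1%:R / 2%:R < a -> a <= 1 ->
  exists2 C : R, 0 < C & forall n r, 0 < r ->
  (\sum_(u <- word_pairs n) mu (close_set a u r) <= (2 ^+ n + C * 4 ^+ n * r)%:E)%E.
Proof.
move=> a2 a1.
have a0 : 0 < a by apply: lt_trans a2; rewrite divr_gt0.
have [C C0 H] := measure_sublevel R.
(* K solves K / a + 1 = 2 K, the balance required by the induction step; it is positive because a >
   1/2. *)
pose K := 1 / (2 - 1 / a).
have ia : a^-1 < 2.
  by rewrite invf_plt ?posrE //; move: a2; rewrite mul1r.
have K0 : 0 < K by rewrite divr_gt0 // mul1r subr_gt0.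
exists (C * K); first by rewrite mulr_gt0.
elim=> [|n IH] r r0.
  rewrite big_cons big_nil adde0 expr0.
  apply: (@le_trans _ _ (mu `[a, 668%:R / 1000%:R])).
    by apply: le_measure; rewrite ?inE //; [exact: measurable_close_set|exact: subIsetl].
  apply: (@le_trans _ _ 1%E); last first.
    by rewrite lee_fin lerDl mulr1 mulr_ge0 ?(ltW r0) // mulr_ge0 // ltW.
  rewrite lebesgue_measure_itv /= lte_fin; case: ifP => _; last exact: lee01.
  by rewrite -EFinB lee_fin; lra.
rewrite big_word_pairsS.
apply: (@le_trans _ _ (\sum_(u <- word_pairs n) (mu (close_set a u (r / a)) + (C * r)%:E
    + ((C * r)%:E + mu (close_set a u (r / a)))))%E).
  apply: lee_sum => -[v w] _ /=.
  have h1 b : (mu (close_set a (b :: v, b :: w) r) <= mu (close_set a (v, w) (r / a)))%E.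
    by apply: le_measure; rewrite ?inE; [exact: measurable_close_set..|exact: close_set_cons].
  have h2 v' w' : (mu (close_set a (true :: v', false :: w') r) <= (C * r)%:E)%E.
    apply: le_trans (_ : (mu (sublevel (diff_poly (true :: v', false :: w')) r) <= _)%E).
      apply: le_measure; rewrite ?inE; [exact: measurable_close_set|exact: measurable_sublevel|].
      exact/close_set_sublevel/ltW.
    apply: H => //; first exact: digit_diff_poly.
    by rewrite coefB !coef_word_poly /= subr0.
  by apply: leeD; apply: leeD => //; rewrite close_setC.
rewrite !big_split /= !big_words_const.
have := IH (r / a) (divr_gt0 r0 a0).
set S := (\sum_(u <- _) _)%E => hS.
apply: (@le_trans _ _ ((2 ^+ n + C * K * 4 ^+ n * (r / a))%:E + (4 ^+ n * (C * r))%:E + 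
  ((4 ^+ n * (C * r))%:E + (2 ^+ n + C * K * 4 ^+ n * (r / a))%:E))%E).
  by apply: leeD; apply: leeD.
rewrite -!EFinD lee_fin !exprS.
have EK : K * (2 - 1 / a) = 1.
  by rewrite /K divfK // gt_eqF // mul1r subr_gt0.
rewrite [leLHS](_ : _ = 2 * 2 ^+ n + C * 4 ^+ n * r * 2 * (K / a + K * (2 - 1 / a))).
  rewrite lerD2l.
  rewrite [X in X <= _](_ : _ = C * K * (4 * 4 ^+ n) * r) //; ring.
rewrite EK; ring.
Qed.

End Words.

(** * Almost sure bound on the number of close pairs *)

Section BorelCantelli.
Variable R : realType.
Notation mu := (@lebesgue_measure R).
Implicit Types (a l r : R) (u : seq bool * seq bool).

Definition close_count n r l : nat :=
  count (fun u => `|(diff_poly R u).[l]| < r) (word_pairs n).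

Lemma sum_indic_close_set a n r l : a <= l <= 668%:R / 1000%:R ->
  \sum_(u <- word_pairs n) \1_(close_set a u r) l = (close_count n r l)%:R :> R.
Proof.
move=> al; rewrite /close_count -sum1_count natr_sum [RHS]big_mkcond /=.
apply: eq_bigr => u _; rewrite indicE; case: ifPn => h.
  by rewrite mem_set //; split; rewrite /= ?in_itv.
by rewrite memNset // => -[_] /=; apply/negP.
Qed.

Definition crowded a n r (c : R) : set R :=
  `[a, 668%:R / 1000%:R] `&` [set l | c <= (close_count n r l)%:R].

(** Markov's inequality for the sum of the indicators of the [close_set]s, which is [close_count] on
    [a, 0.668] and vanishes elsewhere. *)
Lemma markov_close_count a n r (c : R) : 0 < c ->
  (c%:E * mu (crowded a n r c) <= \sum_(u <- word_pairs n) mu (close_set a u r))%E /\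
  measurable (crowded a n r c).
Proof.
move=> c0; rewrite /crowded.
pose g : R -> R := fun l => \sum_(u <- word_pairs n) \1_(close_set a u r) l.
have mg : measurable_fun setT g.
  by apply: measurable_sum => u; apply: measurable_indic; exact: measurable_close_set.
have g0 l : 0 <= g l by rewrite /g sumr_ge0 // => u _; rewrite indicE ler0n.
have E : `[a, 668%:R / 1000%:R] `&` [set l | c <= (close_count n r l)%:R] =
    setT `&` [set l | (c%:E <= `|(g l)%:E|)%E].
  apply/seteqP; split => l /=.
    move=> [lI hc]; split => //; rewrite lee_fin ger0_norm // /g sum_indic_close_set //.
  move=> [_]; rewrite lee_fin ger0_norm // => hc.
  have lI : l \in `[a, 668%:R / 1000%:R].
    apply: contraLR hc => lI; rewrite -ltNge /g big1 // => u _.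
    by rewrite indicE memNset // => -[lI' _]; case/negP: lI; exact: lI'.
  by split => //; rewrite -(@sum_indic_close_set a) //; move: lI; rewrite in_itv.
have mgE : measurable_fun setT (EFin \o g) by exact/measurable_EFinP.
rewrite E; split; last first.
  by apply: emeasurable_fun_c_infty => //; exact: measurableT_comp.
have := @le_integral_comp_abse _ _ R mu setT measurableT (EFin \o g) c id
  (@measurable_id _ _ _) (fun _ h => h) _ mgE c0.
move=> /(_ _)/le_trans -> //.
under eq_integral => l _ do rewrite /= ger0_norm // /g -sumEFin.
rewrite ge0_integral_sum //.
- apply: lee_sum => u _; rewrite integral_indic ?setIT //; exact: measurable_close_set.
- by move=> u; apply/measurable_EFinP/measurable_indic; exact: measurable_close_set.
Qed.

(** The mean count is O(2^n); the extra factor (n + 1)(n + 2) makes the measures summable and, being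
    polynomial, does not affect the dimension. *)
Definition crowded_level a n : set R :=
  crowded a n (4 / 2 ^+ n) (n.+1%:R * n.+2%:R * 2 ^+ n).

(** Borel-Cantelli. At r = 4 / 2^n the sum of measures is at most (1 + 4 C) 2^n = K 2^n, so level n
    has measure at most K / ((n + 1)(n + 2)), which telescopes to a total of at most K. *)
Lemma crowded_null a : 1%:R / 2%:R < a -> a <= 1 -> mu (lim_sup_set (crowded_level a)) = 0.
Proof.
move=> a2 a1; have [C C0 H] := sum_measure_close_set a2 a1.
have e2 n : 0 < 2 ^+ n :> R by rewrite exprn_gt0.
have c0 n : 0 < n.+1%:R * n.+2%:R * 2 ^+ n :> R by rewrite !mulr_gt0.
apply: lim_sup_set_cvg0 => [n|]; first by have [] := markov_close_count a n (4 / 2 ^+ n) (c0 n).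
pose K := 1 + 4 * C.
have hb n : (mu (crowded_level a n) <= (K / n.+1%:R - K / n.+2%:R)%:E)%E.
  have [hm _] := markov_close_count a n (4 / 2 ^+ n) (c0 n).
  have h := H n (4 / 2 ^+ n) (divr_gt0 _ (e2 n)).
  have {}hm := le_trans hm (h (ltr0Sn _ _)).
  rewrite -(@lee_pmul2l _ (n.+1%:R * n.+2%:R * 2 ^+ n)%:E) ?lte_fin //.
  apply: le_trans hm _; rewrite -EFinM lee_fin.
  rewrite [leLHS](_ : _ = K * 2 ^+ n); last first.
    rewrite (_ : 4 ^+ n = 2 ^+ n * 2 ^+ n :> R) /K; last by rewrite -exprMn -natrM.
    by field; rewrite gt_eqF.
  rewrite [leRHS](_ : _ = K * 2 ^+ n) //.
  have x0 : 0 < n.+1%:R :> R by [].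
  rewrite -[n.+2%:R]natr1; move: n.+1%:R x0 => x x0.
  by field; rewrite !gt_eqF // addr_gt0.
apply: (@le_lt_trans _ _ K%:E); last exact: ltry.
apply: lime_le; first by apply: is_cvg_nneseries => *; exact: measure_ge0.
apply: nearW => n.
apply: (@le_trans _ _ (\sum_(0 <= i < n) (K / i.+1%:R - K / i.+2%:R)%:E)%E).
  by apply: lee_sum => i _; exact: hb.
rewrite sumEFin lee_fin.
have -> : \sum_(0 <= i < n) (K / i.+1%:R - K / i.+2%:R) = K - K / n.+1%:R.
  elim: n => [|n IH]; first by rewrite big_geq // divr1 subrr.
  by rewrite big_nat_recr //= IH; ring.
by rewrite gerBl divr_ge0 // addr_ge0 // mulr_ge0 // ltW.
Qed.

Lemma ae_close_count : {ae mu, forall l, l \in `](1 / 2 : R), (668%:R / 1000%:R : R)[ ->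
  exists N, forall n, (N <= n)%N ->
    (close_count n (4 / 2 ^+ n) l)%:R <= n.+1%:R * n.+2%:R * 2 ^+ n :> R}.
Proof.
(* Countably many left endpoints exhaust (1/2, 0.668); the shift by 3 keeps [a k] at most 1. *)
pose a k : R := 1 / 2 + k.+3%:R^-1.
have H k : {ae mu, forall l, a k <= l <= 668%:R / 1000%:R ->
    exists N, forall n, (N <= n)%N ->
    (close_count n (4 / 2 ^+ n) l)%:R <= n.+1%:R * n.+2%:R * 2 ^+ n :> R}.
  exists (lim_sup_set (crowded_level (a k))); split.
  - apply: bigcap_measurableType => i _; apply: bigcup_measurable => j _.
    have c0 : 0 < j.+1%:R * j.+2%:R * 2 ^+ j :> R by rewrite !mulr_gt0 // exprn_gt0.
    by have [] := markov_close_count (a k) j (4 / 2 ^+ j) c0.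
  - apply: crowded_null; first by rewrite ltrDl invr_gt0.
    have : k.+3%:R^-1 <= 2^-1 :> R by rewrite lef_pV2 ?posrE // ler_nat.
    by rewrite /a; move: (k.+3%:R^-1) => z; lra.
  - move=> l /= /not_implyP[la hl] N _; apply: contrapT => hN; apply: hl.
    exists N => n Nn; rewrite leNgt; apply/negP => hc; apply: hN.
    by exists n => //; split; rewrite /= ?in_itv //= ltW.
apply: filterS (ae_foralln H) => l hl; rewrite in_itv /= => /andP[l1 l2].
have d0 : 0 < l - 1 / 2 by rewrite subr_gt0.
set z := (l - 1 / 2)^-1; have z0 : 0 < z by rewrite invr_gt0.
have lz : l - 1 / 2 = z^-1 by rewrite invrK.
apply: (hl (Num.truncn z)); rewrite (ltW l2) andbT /a -lerBrDl lz.
rewrite lef_pV2 ?posrE //; apply: ltW; apply: lt_le_trans (truncnS_gt _) _.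
by rewrite ler_nat ltnS -addn2 leq_addr.
Qed.

End BorelCantelli.

(** * Mesh counts *)

(* Cauchy-Schwarz applied to the multiplicities of the values occurring in [t]. *)
Lemma size_sqr_le_undup (T : eqType) (t : seq T) :
  (size t ^ 2 <= size (undup t) * \sum_(x <- t) count_mem x t)%N.
Proof.
have reindex (F : T -> nat) :
    (\sum_(x <- t) F x = \sum_(x <- undup t) count_mem x t * F x)%N.
  rewrite -big_undup_iterop_count; apply: eq_bigr => x _.
  by rewrite Monoid.iteropE iter_addn_0 mulnC.
have -> : size t = (\sum_(x <- undup t) count_mem x t)%N.
  by rewrite -sum1_size reindex; apply: eq_bigr => x _; rewrite muln1.
rewrite reindex; set s := undup t; set m := fun x => count_mem x t.
rewrite -[X in (X ^ 2 <= _)%N]/(\sum_(x <- s) m x)%N -[X in (_ <= _ * X)%N]/(\sum_(x <- s) m x * m x)%N.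
set S1 := (\sum_(x <- s) m x)%N; set S2 := (\sum_(x <- s) m x * m x)%N.
have [k0|k0] := posnP (size s); first by rewrite /S1 (size0nil k0) big_nil.
(* A rescaled variance of the multiplicities, taken in [rat] to have true subtraction. *)
have : 0 <= \sum_(x <- s) ((size s)%:R * (m x)%:R - S1%:R) ^+ 2 :> rat.
  by apply: sumr_ge0 => x _; exact: sqr_ge0.
have -> : \sum_(x <- s) ((size s)%:R * (m x)%:R - S1%:R) ^+ 2 =
    (size s)%:R * ((size s * S2)%:R - (S1 ^ 2)%:R) :> rat.
  rewrite (eq_bigr (fun x => (size s)%:R ^+ 2 * (m x * m x)%:R
    - 2 * (size s)%:R * S1%:R * (m x)%:R + S1%:R ^+ 2)); last first.
    by move=> x _; rewrite natrM; ring.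
  rewrite big_split sumrB /= -!mulr_sumr -!natr_sum -/S1 -/S2.
  rewrite big_const_seq count_predT iter_addr_0 -[_ *+ size s]mulr_natl natrM natrX.
  ring.
by rewrite pmulr_rge0 ?ltr0n // subr_ge0 ler_nat.
Qed.

(** Turns the sum from [size_sqr_le_undup] into the number of pairs of words lying in one column. *)
Lemma count_allpairs_eq (T U : eqType) (f : T -> U) (s : seq T) :
  count (fun u => f u.1 == f u.2) [seq (v, w) | v <- s, w <- s] =
  (\sum_(x <- map f s) count_mem x (map f s))%N.
Proof.
rewrite -sum1_count big_mkcond big_allpairs /= big_map; apply: eq_bigr => v _.
rewrite count_map -sum1_count [RHS]big_mkcond; apply: eq_bigr => w _ /=.
by rewrite eq_sym.
Qed.

Section Geometry.
Variable R : realType.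
Implicit Types (l d x y : R) (p : R * R) (F E : set (R * R)).

Lemma floor_truncn x : 0 <= x -> Num.floor x = Posz (Num.truncn x).
Proof. by move=> x0; rewrite truncn_floor x0 gez0_abs // floor_ge0. Qed.

Definition met_cells d E : set (int * int) := [set ij | mesh_cube d ij `&` E !=set0].

Lemma mesh_cubeP d ij p : 0 < d -> 0 <= p.1 -> 0 <= p.2 ->
  mesh_cube d ij p <->
  ij = (Posz (Num.truncn (p.1 / d)), Posz (Num.truncn (p.2 / d))).
Proof.
move=> d0 p1 p2; rewrite -!floor_truncn ?divr_ge0 ?(ltW d0) //.
have K x (i : int) : (i%:~R * d <= x < (i + 1)%:~R * d) <-> i = Num.floor (x / d).
  rewrite -ler_pdivlMr // -ltr_pdivrMr //; split=> [/floor_def -> //|->].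
  by rewrite floor_itv.
case: ij => i j; split; first by move=> [/K /= -> /K /= ->].
by case=> -> ->; split; apply/K.
Qed.

Lemma mesh_count_le d E (s : seq (int * int)) :
  met_cells d E `<=` [set` s] -> (mesh_count d E <= size s)%N.
Proof.
move=> h; have fin : finite_set (met_cells d E) by exact: sub_finite_set h _.
rewrite /mesh_count -/(met_cells d E).
apply: leq_trans (size_undup s); rewrite -card_fseq; apply: fsubset_leq_card.
apply/fsubsetP => ij; rewrite in_fset_set // inE => /h /= ?.
by rewrite !inE.
Qed.

(** Finiteness matters: [fset_set] sends an infinite set to the empty one, and the count would be
    0. *)
Lemma mesh_count_ge d E (s : seq (int * int)) : finite_set (met_cells d E) ->
  uniq s -> {in s, forall ij, met_cells d E ij} -> (size s <= mesh_count d E)%N.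
Proof.
move=> fin us hs; rewrite /mesh_count -/(met_cells d E).
rewrite -{1}(undup_id us) -card_fseq; apply: fsubset_leq_card.
by apply/fsubsetP => ij; rewrite in_fset_set // !inE => /hs.
Qed.

Lemma quarter_lt l : l < 668%:R / 1000%:R -> 4^-1 < 1 - l.
Proof. by move=> h; lra. Qed.

(** * Bounds on the mesh count of the attractor *)

Section Attractor.
Variables (l : R) (F : set (R * R)).
Hypotheses (l2 : 1 / 2 < l) (l1 : l < 668%:R / 1000%:R) (HF : is_inhom_attractor l F).

Let l0 : 0 < l. Proof. by apply: lt_trans l2; rewrite divr_gt0. Qed.

(** The empty word gives C itself; prepending a letter applies one of the two maps, which scales the
    height by l. *)
Lemma attractor_fibre w y : 0 <= y <= l ^+ size w -> F (word_pt l w, y).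
Proof.
have [_ _ _ E] := HF; elim: w y => [|b w IH] y /andP[y0 yl]; rewrite E.
  by right; rewrite /condC /= word_pt_nil y0.
left; have Fw : F (word_pt l w, y / l).
  by apply: IH; rewrite divr_ge0 ?(ltW l0) //= ler_pdivrMr // -exprSr.
have yE : y = l * (y / l) by rewrite mulrC divfK // gt_eqF.
by case: b {yl}; [right|left]; exists (word_pt l w, y / l) => //;
   rewrite ?/S1 ?/S0 /= -yE word_pt_cons ?mulr0 ?mulr1 ?add0r // addrC.
Qed.

(** Unrolling the fixed-point equation n times puts a point in the image of C under k < n maps, or
    in the image of F, hence of the unit square, under n maps. *)
Lemma attractor_cases n p : F p ->
  (exists2 k, (k < n)%N & exists2 w, w \in words k &
     p.1 = word_pt l w /\ 0 <= p.2 <= l ^+ k) \/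
  (0 <= p.1 <= 1 /\ 0 <= p.2 <= l ^+ n).
Proof.
have [sq _ _ E] := HF; elim: n p => [|n IH] p Fp.
  by right; have [? ?] := sq p Fp.
have [p1 p2] := sq p Fp.
have step b q : F q -> p = (l * q.1 + (1 - l) * (b : bool)%:R, l * q.2) ->
    (exists2 k, (k < n.+1)%N & exists2 w, w \in words k &
     p.1 = word_pt l w /\ 0 <= p.2 <= l ^+ k) \/
    (0 <= p.1 <= 1 /\ 0 <= p.2 <= l ^+ n.+1).
  move=> /IH[[k kn [w wk [q1 /andP[q2 q3]]]]|[_ /andP[q2 q3]]] pE.
    left; exists k.+1 => //; exists (b :: w); first by move: wk; rewrite !mem_words.
    split; first by rewrite pE /= q1 word_pt_cons addrC.
    by rewrite pE /= exprS mulr_ge0 ?(ltW l0) //= ler_wpM2l // ltW.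
  right; split=> //.
  by rewrite pE /= exprS mulr_ge0 ?(ltW l0) //= ler_wpM2l // ltW.
move: Fp; rewrite E => -[[[q Fq pE]|[q Fq pE]]|[pE p2']].
- by apply: (step false q) => //; rewrite mulr0 addr0 -pE.
- by apply: (step true q) => //; rewrite mulr1 -pE.
- by left; exists 0%N => //; exists [::]; rewrite ?inE // word_pt_nil expr0.
Qed.

Definition cover_cells d n : seq (int * int) :=
  flatten [seq [seq (Posz (Num.truncn (word_pt l w / d)), Posz j) |
      w <- words k, j <- iota 0 (Num.truncn (l ^+ k / d)).+1] | k <- iota 0 n] ++
  [seq (Posz i, Posz j) | i <- iota 0 (Num.truncn (1 / d)).+1,
                          j <- iota 0 (Num.truncn (l ^+ n / d)).+1].

Lemma size_cover_cells d n : size (cover_cells d n) =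
  (\sum_(k < n) 2 ^ k * (Num.truncn (l ^+ k / d)).+1 +
   (Num.truncn (1 / d)).+1 * (Num.truncn (l ^+ n / d)).+1)%N.
Proof.
rewrite size_cat size_allpairs !size_iota size_flatten /shape -map_comp sumnE big_map.
congr (_ + _)%N; rewrite -[n in iota 0 n]subn0 -/(index_iota 0 n) big_mkord.
by apply: eq_bigr => k _; rewrite /comp size_allpairs size_words size_iota.
Qed.

Lemma met_cells_cover d n : 0 < d -> met_cells d F `<=` [set` cover_cells d n].
Proof.
move=> d0 ij [p [hij Fp]] /=; have [sq _ _ _] := HF.
have [/andP[p1 p1'] /andP[p2 p2']] := sq p Fp.
move/(mesh_cubeP ij d0 p1 p2): hij => ->; rewrite mem_cat.
have trle x y : x <= y -> Num.truncn (x / d) \in iota 0 (Num.truncn (y / d)).+1.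
  move=> xy; rewrite mem_iota /= add0n ltnS; apply: le_truncn.
  by rewrite ler_wpM2r // invr_ge0 ltW.
have [[k kn [w wk [-> /andP[_ hp]]]]|[_ /andP[_ hp]]] := attractor_cases n Fp.
  apply/orP; left; apply/flatten_mapP; exists k; first by rewrite mem_iota.
  by apply/allpairsP; exists (w, Num.truncn (p.2 / d)); split => //=; exact: trle.
apply/orP; right; apply/allpairsP.
by exists (Num.truncn (p.1 / d), Num.truncn (p.2 / d)); split => //=; exact: trle.
Qed.

Lemma finite_met_cells d : 0 < d -> finite_set (met_cells d F).
Proof. by move=> d0; exact: sub_finite_set (@met_cells_cover d 0 d0) _. Qed.

Definition column d w : int := Num.floor (word_pt l w / d).

(** An occupied column contains a whole vertical segment of height l^n standing on the axis. *)
Lemma mesh_count_ge_columns d n : 0 < d ->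
  (size (undup (map (column d) (words n))) * (Num.truncn (l ^+ n / d)).+1
   <= mesh_count d F)%N.
Proof.
move=> d0; set U := undup _; set m := _.+1.
pose s := [seq (c, Posz j) | c <- U, j <- iota 0 m].
rewrite -[m](size_iota 0) -(size_allpairs (fun c j => (c, Posz j))) -/s.
apply: mesh_count_ge; first exact: finite_met_cells.
  by apply: allpairs_uniq; rewrite ?undup_uniq ?iota_uniq // => -[? ?] [? ?] _ _ [-> ->].
move=> ij /allpairsP[[c j] [cU]]; rewrite mem_iota add0n => /andP[_ jm] -> {ij}.
move: cU jm; rewrite [_.1]/= [_.2]/= => cU jm.
move: cU; rewrite mem_undup => /mapP[w wn ->].
have ln0 : 0 <= l ^+ n / d by rewrite divr_ge0 ?exprn_ge0 ?ltW.
(* The lower edge of the j-th square of the column is at height j d, still on the segment. *)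
have jd : 0 <= j%:R * d <= l ^+ n.
  rewrite mulr_ge0 ?(ltW d0) //= -ler_pdivlMr //.
  by move: jm; rewrite ltnS truncn_ge_nat.
have Fp : F (word_pt l w, j%:R * d).
  by apply: attractor_fibre; move: wn; rewrite mem_words => /eqP ->.
exists (word_pt l w, j%:R * d); split => //.
have [sq _ _ _] := HF; have [/andP[p1 _] /andP[p2 _]] := sq _ Fp.
apply/mesh_cubeP => //=; rewrite /column floor_truncn ?divr_ge0 ?(ltW d0) //.
by rewrite mulfK ?gt_eqF // natrK.
Qed.

(** Cauchy-Schwarz bounds (2^n)^2 by the number of columns times the number of pairs in a common
    column, and such pairs are close. *)
Lemma columns_close d n : 0 < d -> d <= 2 ^- n ->
  (4 ^ n <= size (undup (map (column d) (words n))) * close_count n (4 / 2 ^+ n) l)%N.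
Proof.
move=> d0 dn.
have := size_sqr_le_undup (map (column d) (words n)).
rewrite size_map size_words -expnM mulnC expnM => /leq_trans; apply.
rewrite leq_mul2l -count_allpairs_eq; apply/orP; right; apply: sub_count => -[v w] /= /eqP E.
have wd (u : seq bool) : (column d u)%:~R * d <= word_pt l u < (column d u)%:~R * d + d.
  rewrite -[X in _ + X]mul1r -mulrDl -(intrD _ _ 1).
  by rewrite -ler_pdivlMr // -ltr_pdivrMr // floor_itv.
have close : `|word_pt l v - word_pt l w| < d.
  have := wd v; have := wd w; rewrite E; move: (_%:~R * d) => z.
  by move=> /andP[w1 w2] /andP[v1 v2]; rewrite ltr_norml; apply/andP; split; lra.
(* Dividing |x_v - x_w| < 2^-n by 1 - l > 1/4 yields the threshold 4 / 2^n. *)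
have l4 := quarter_lt l1.
move: close; rewrite diff_polyE /word_pt -mulrBr normrM gtr0_norm; last exact: lt_trans l4.
set z := `|_| => hz; have z0 : 0 <= z by exact: normr_ge0.
rewrite ltr_pdivlMr ?exprn_gt0 //.
have : (1 - l) * z < 2 ^- n by exact: lt_le_trans dn.
rewrite -[X in _ < X]mul1r ltr_pdivlMr ?exprn_gt0 //.
have e0 : 0 < 2 ^+ n :> R by rewrite exprn_gt0.
have : 0 <= z * 2 ^+ n by rewrite mulr_ge0 // ltW.
rewrite -mulrA; move: (z * 2 ^+ n) => t t0 ht.
have := ler_wpM2r t0 (ltW l4); rewrite mulrC ler_pdivrMr // => h.
by apply: le_lt_trans h _; rewrite -[ltRHS]mul1r ltr_pM2r.
Qed.

(** With u occupied columns and q = (n + 1)(n + 2), one has 4^n <= u q 2^n and u l^n 2^n <= N;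
    multiply the first by l^n and the second by q. *)
Lemma mesh_count_lower d n : 0 < d -> d <= 2 ^- n ->
  (close_count n (4 / 2 ^+ n) l)%:R <= n.+1%:R * n.+2%:R * 2 ^+ n :> R ->
  (4 * l) ^+ n <= n.+1%:R * n.+2%:R * (mesh_count d F)%:R.
Proof.
move=> d0 dn hc.
have := columns_close d0 dn; have := mesh_count_ge_columns n d0.
rewrite -!(ler_nat R) => h2 h1.
have ln0 : 0 < l ^+ n by rewrite exprn_gt0.
have e0 : 0 < 2 ^+ n :> R by rewrite exprn_gt0.
have h3 : l ^+ n * 2 ^+ n <= (Num.truncn (l ^+ n / d)).+1%:R.
  apply: le_trans (ltW (truncnS_gt _)); rewrite ler_wpM2l ?(ltW ln0) //.
  by rewrite -[leLHS]invrK lef_pV2 ?posrE ?invr_gt0.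
move: h1 h2; rewrite !natrM; set u := (size _)%:R; set m := (Num.truncn _).+1%:R in h3 *.
set N := (mesh_count d F)%:R; set c := (close_count _ _ _)%:R in hc *.
move=> h1 h2.
have u0 : 0 <= u by [].
set q := n.+1%:R * n.+2%:R in hc *.
have q0 : 0 <= q by rewrite mulr_ge0.
apply: le_trans (ler_wpM2l q0 h2).
rewrite mulrCA; apply: (@le_trans _ _ (u * (q * (l ^+ n * 2 ^+ n)))); last first.
  by rewrite ler_wpM2l // ler_wpM2l.
have -> : u * (q * (l ^+ n * 2 ^+ n)) = u * (q * 2 ^+ n) * l ^+ n by ring.
rewrite exprMn ler_wpM2r ?(ltW ln0) //.
by rewrite -[leLHS]natrX; apply: le_trans h1 _; rewrite ler_wpM2l.
Qed.

(** Level k costs at most 2^k (2 2^n l^k + 1) squares. As 2 l > 1, the geometric sum is of the order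
    of its last term, whence 2 / (2 l - 1). *)
Lemma mesh_count_upper d n : 2 ^- n.+1 < d -> 
  (mesh_count d F)%:R <= (2 / (2 * l - 1) + 16) * (4 * l) ^+ n.
Proof.
move=> dn; have e0 k : 0 < 2 ^+ k :> R by rewrite exprn_gt0.
have d0 : 0 < d by apply: lt_trans dn; rewrite invr_gt0.
have dV : d^-1 <= 2 ^+ n.+1.
  by rewrite -[leRHS]invrK lef_pV2 ?posrE ?invr_gt0 // ltW.
have h : (mesh_count d F)%:R <= (size (cover_cells d n))%:R :> R.
  by rewrite ler_nat; apply: mesh_count_le; exact: met_cells_cover.
apply: le_trans h _; rewrite size_cover_cells natrD natrM natr_sum.
have tr y : 0 <= y -> (Num.truncn (y / d)).+1%:R <= 2 * 2 ^+ n * y + 1 :> R.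
  move=> y0; rewrite -natr1 lerD2r.
  have yd : 0 <= y / d by rewrite divr_ge0 // ltW.
  have /andP[h _] := truncn_itv yd; apply: le_trans h _.
  by rewrite mulrC -exprS ler_wpM2r.
have lm1 : 0 < 2 * l - 1 by have := l2; lra.
have lk0 k : 0 <= l ^+ k by rewrite exprn_ge0 // ltW.
have big k : 1 <= (2 * l) ^+ k by rewrite exprn_ege1 //; lra.
have S1 : \sum_(k < n) (2 ^ k * (Num.truncn (l ^+ k / d)).+1)%:R <=
   2 * 2 ^+ n * ((2 * l) ^+ n / (2 * l - 1)) + 2 ^+ n.
  apply: (@le_trans _ _ (\sum_(k < n) (2 * 2 ^+ n * (2 * l) ^+ k + 2 ^+ k))).
    apply: ler_sum => k _; rewrite natrM natrX.
    apply: le_trans (ler_wpM2l (ltW (e0 k)) (tr _ (lk0 k))) _.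
    by rewrite mulrDr mulr1 exprMn mulrCA.
  rewrite big_split /= -mulr_sumr lerD //.
    rewrite ler_wpM2l // ?mulr_ge0 ?(ltW (e0 n)) // ler_pdivlMr //.
    by rewrite [leLHS]mulrC -subrX1 gerBl.
  have := subrX1 (2 : R) n; rewrite (_ : 2 - 1 = 1) ?mul1r => [<-|]; last by ring.
  by rewrite gerBl.
have S2 := ler_pM (ler0n _ _) (ler0n _ _) (tr 1 ler01) (tr _ (lk0 n)).
apply: le_trans (lerD S1 S2) _.
have e1 : 1 <= 2 ^+ n :> R by rewrite exprn_ege1 // ler1n.
have := big n; have -> : (4 * l) ^+ n = 2 ^+ n * (2 * l) ^+ n.
  by rewrite -exprMn; congr (_ ^+ _); ring.
have -> : 2 * 2 ^+ n * l ^+ n = 2 * (2 * l) ^+ n by rewrite exprMn; ring.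
set u := (2 * l) ^+ n; set v := 2 ^+ n in e1 *; set w := (2 * l - 1)^-1.
move: u v w e1 => u v w v1 u1.
(* What remains, v + (2 v + 1)(2 u + 1), is at most 10 u v since u, v >= 1, so the constant 16
   suffices. *)
have h1 : 0 <= (u - 1) * (v - 1) by rewrite mulr_ge0 // subr_ge0.
lra.
Qed.

End Attractor.
End Geometry.

(** * Box dimension *)

Section Limit.
Variable R : realType.
Implicit Types (l d x c : R).

Lemma ln2_gt0 : 0 < ln 2 :> R. Proof. by rewrite ln_gt0 // ltr1n. Qed.

Lemma dyadic_scale d : 0 < d -> d <= 1 -> let n := Num.truncn (- ln d / ln 2) in
  2 ^- n.+1 < d /\ d <= 2 ^- n.
Proof.
move=> d0 d1 n.
have t0 : 0 <= - ln d / ln 2 by rewrite divr_ge0 ?(ltW ln2_gt0) // oppr_ge0 ln_le0.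
have /andP[h1 h2] := truncn_itv t0.
have e k : 0 < 2 ^- k :> R by rewrite invr_gt0 exprn_gt0.
have lne k : ln (2 ^- k) = - (k%:R * ln 2) :> R.
  by rewrite lnV ?posrE ?exprn_gt0 // lnXn // mulr_natl.
split.
  by rewrite -ltr_ln ?posrE // lne ltrNl -ltr_pdivrMr ?ln2_gt0.
by rewrite -ler_ln ?posrE // lne lerNr -ler_pdivlMr ?ln2_gt0.
Qed.

(** This is ln y <= y at y = c x; a small slope c will absorb the polynomial factor. *)
Lemma ln_le_linear x c : 0 < x -> 0 < c -> ln x <= c * x - ln c.
Proof.
move=> x0 c0; rewrite lerBrDr addrC -lnM ?posrE //.
have cx : 0 < c * x by rewrite mulr_gt0.
by have := ln_sublinear cx; rewrite ?lerBlDr; move=> /ltW.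
Qed.

(** The hypotheses give ln N = n ln b + O(ln n), while - ln d = n ln 2 + O(1). *)
Lemma log_ratio_cvg (N : R -> R) (b C : R) n0 : 1 < b -> 1 <= C ->
  (forall d n, 0 < d -> d < 1 -> (n0 <= n)%N -> 2 ^- n.+1 < d -> d <= 2 ^- n ->
     b ^+ n <= n.+1%:R * n.+2%:R * N d /\ N d <= C * b ^+ n) ->
  ln (N d) / (- ln d) @[d --> (0:R)^'+] --> ln b / ln 2.
Proof.
move=> b1 C1 H; apply/cvgrPdist_le => eps eps0.
have L0 := ln2_gt0; have b0 : 0 < b by exact: lt_trans b1.
have lb0 : 0 < ln b by exact: ln_gt0.
have lC0 : 0 <= ln C by rewrite ln_ge0.
(* With this slope, 2 ln (n + 2) costs at most eps t / 2 + eps ln 2 + 2 |ln dl|, where t = - ln d.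
   [K] collects the constants, including ln b for rounding n. *)
pose dl := eps * ln 2 / 4.
have dl0 : 0 < dl by rewrite !mulr_gt0.
pose K := ln b + ln C + eps * ln 2 + 2 * `|ln dl|.
have eL0 : 0 < eps * ln 2 by rewrite mulr_gt0.
have K0 : 0 < K by rewrite /K; have := normr_ge0 (ln dl); lra.
(* For t > T, the first summand forces n >= n0 and the second K <= eps t / 2. *)
pose T := n0.+1%:R * ln 2 + 2 * K / eps.
near=> d.
have d0 : 0 < d by near: d; exact: nbhs_right_gt.
have dT : d < expR (- T) by near: d; apply: nbhs_right_lt; exact: expR_gt0.
set t := - ln d.
have Tt : T < t.
  by rewrite /t ltrNr -(expRK (- T)) ltr_ln ?posrE ?expR_gt0.
have T1 : n0.+1%:R * ln 2 <= T by rewrite lerDl divr_ge0 ?mulr_ge0 ?(ltW K0) ?(ltW eps0).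
have T2 : 2 * K / eps <= T by rewrite lerDr mulr_ge0 // ltW.
have t0 : 0 < t by apply: le_lt_trans Tt; apply: le_trans T1; rewrite mulr_ge0 // ltW.
have d1 : d < 1.
  by rewrite -ltr_ln ?posrE // ln1 -oppr_gt0.
have [] := dyadic_scale d0 (ltW d1); rewrite -/t; set n := Num.truncn _ => dn1 dn2.
have tL0 : 0 <= t / ln 2 by rewrite divr_ge0 ?ltW.
have /andP[n1 n2] := truncn_itv tL0; rewrite -/n in n1 n2.
have n0n : (n0 <= n)%N.
  rewrite truncn_ge_nat // ler_pdivlMr //; apply: ltW; apply: le_lt_trans Tt.
  by apply: le_trans T1; rewrite ler_wpM2r ?(ltW L0) // ler_nat.
have [h1 h2] := H d n d0 d1 n0n dn1 dn2.
have bn0 : 0 < b ^+ n by rewrite exprn_gt0.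
have q0 : 0 < n.+1%:R * n.+2%:R :> R by rewrite mulr_gt0.
have N0 : 0 < N d by rewrite -(pmulr_rgt0 _ q0); exact: lt_le_trans h1.
have U : ln (N d) <= ln C + n%:R * ln b.
  rewrite mulr_natl -lnXn // -lnM ?posrE //; last exact: lt_le_trans C1.
  by rewrite ler_ln ?posrE // mulr_gt0 // (lt_le_trans ltr01).
have Lo : n%:R * ln b - 2 * ln n.+2%:R <= ln (N d).
  have : ln (b ^+ n) <= ln (n.+1%:R * n.+2%:R * N d) by rewrite ler_ln ?posrE // mulr_gt0.
  rewrite lnXn // -[ln b *+ n]mulr_natl lnM ?posrE // lnM ?posrE //.
  have : ln n.+1%:R <= ln n.+2%:R :> R by rewrite ler_ln ?posrE // ler_nat.
  move: (ln n.+1%:R) (ln n.+2%:R) (n%:R * ln b) (ln (N d)) => u v w z; clear; lra.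
have hl : ln n.+2%:R <= dl * (t / ln 2 + 2) + `|ln dl|.
  apply: le_trans (ln_le_linear (ltr0Sn _ _) dl0) _.
  apply: lerD; last by rewrite -normrN ler_norm.
  by rewrite ler_wpM2l ?(ltW dl0) // -addn2 natrD lerD2r.
have dlE : dl * (t / ln 2 + 2) = eps * t / 4 + eps * ln 2 / 2.
  by rewrite /dl; field; rewrite gt_eqF.
have nb1 : n%:R * ln b <= t / ln 2 * ln b by rewrite ler_wpM2r ?(ltW lb0).
have nb2 : t / ln 2 * ln b <= n%:R * ln b + ln b.
  by rewrite -[X in _ + X]mul1r -mulrDl natr1 ler_wpM2r ?(ltW lb0) // ltW.
have Kt : K <= eps * t / 2.
  move: (le_lt_trans T2 Tt); rewrite ltr_pdivrMr // => h; clear -h; lra.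
have -> : ln b / ln 2 - ln (N d) / t = (t / ln 2 * ln b - ln (N d)) / t.
  by field; rewrite !gt_eqF.
rewrite normrM normfV (gtr0_norm t0) ler_pdivrMr //.
move: Kt hl nb1 nb2 U Lo (normr_ge0 (ln dl)); rewrite dlE /K.
move: (n%:R * ln b) (t / ln 2 * ln b) (ln (N d)) (ln C) lC0 (ln b) lb0 (ln n.+2%:R).
move: (eps * t) (eps * ln 2) eL0 `|ln dl| => e1 e2 e20 e3 u v w x x0 y y0 z; clear -e20 x0 y0.
by move=> *; rewrite ler_norml; apply/andP; split; lra.
Unshelve. all: by end_near.
Qed.

End Limit.

Theorem theorem2p2 (R : realType) :
  {ae (@lebesgue_measure R), forall l : R,
    l \in `](1 / 2 : R), (668%:R / 1000%:R : R)[ ->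
    forall F : set (R * R), is_inhom_attractor l F ->
      has_box_dim F (ln (4 * l) / ln 2)}.
Proof.
(* The exceptional null set comes from the words alone, so it is independent of F. *)
apply: negligibleS (ae_close_count R) => l; apply: contra_not => hl lI F HF.
have [n0 hn0] := hl lI; move: lI; rewrite in_itv /= => /andP[l2 l1].
apply: (@log_ratio_cvg R (fun d => (mesh_count d F)%:R) (4 * l)
  (2 / (2 * l - 1) + 16) n0) => [||d n d0 d1 n0n dn1 dn2].
- by lra.
- have : 0 <= 2 / (2 * l - 1) by rewrite divr_ge0 //; lra.
  by lra.
- split; first by apply: mesh_count_lower => //; exact: hn0.
  exact: mesh_count_upper.
Qed.
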